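(* Let $A$ and $B$ be phased coproducts of the same family of objects $(A_i)_{i \in J}$ in a category, with respective coprojections $\kappa_i \colon A_i \to A$ and $\mu_i \colon A_i \to B$ for $i \in J$. Then any morphism $f \colon A \to B$ with $f \circ \kappa_i = \mu_i$ for all $i \in J$ is an isomorphism. Conversely, any object $C$ with an isomorphism $g \colon A \to C$ forms a phased coproduct of the $A_i$ with coprojections $\nu_i := g \circ \kappa_i$.
   Context: In any category, a phased coproduct of a family $(A_i)_{i \in J}$ of objects is an object $A$ with morphisms $\kappa_i \colon A_i \to A$ (coprojections) such that: (i) for every family $f_i \colon A_i \to B$ there is $f \colon A \to B$ with $f \circ \kappa_i = f_i$ for all $i$; (ii) any $f, f' \colon A \to B$ with $f \circ \kappa_i = f' \circ \kappa_i$ for all $i$ satisfy $f' = f \circ U$ for some endomorphism $U$ of $A$ with $U \circ \kappa_i = \kappa_i$ for all $i$. *)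

(* Defs.v *)
Set Implicit Arguments.
Unset Strict Implicit.
Unset Printing Implicit Defensive.

Declare Scope cat_scope.
Delimit Scope cat_scope with cat.

Record category : Type := Category {
  obj :> Type;
  hom : obj -> obj -> Type;
  idm : forall a : obj, hom a a;
  comp : forall a b c : obj, hom b c -> hom a b -> hom a c;
  comp_idl : forall (a b : obj) (f : hom a b), comp (idm b) f = f;
  comp_idr : forall (a b : obj) (f : hom a b), comp f (idm a) = f;
  comp_assoc : forall (a b c d : obj) (h : hom c d) (g : hom b c) (f : hom a b),
    comp h (comp g f) = comp (comp h g) f
}.

Arguments hom {_} _ _.
Arguments idm {_} _.
Arguments comp {_ _ _ _} _ _.

Notation "g \oc f" := (comp g f)
  (at level 40, left associativity) : cat_scope.

Local Open Scope cat_scope.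

Definition is_iso (C : category) (a b : C) (f : hom a b) : Prop :=
  exists g : hom b a, g \oc f = idm a /\ f \oc g = idm b.

Definition phased_coproduct (C : category) (J : Type) (A_ : J -> C)
    (A : C) (kappa : forall i : J, hom (A_ i) A) : Prop :=
  (forall (B : C) (f_ : forall i : J, hom (A_ i) B),
     exists f : hom A B, forall i : J, f \oc kappa i = f_ i)
  /\
  (forall (B : C) (f f' : hom A B),
     (forall i : J, f \oc kappa i = f' \oc kappa i) ->
     exists U : hom A A,
       (forall i : J, U \oc kappa i = kappa i) /\ f' = f \oc U).

(* Main.v *)
(** A morphism between phased coproducts commuting with the coprojections has a
    section that again commutes with the coprojections, hence itself has a
    section; so that section is a two-sided inverse. *)

Require Import Defs.

Local Open Scope cat_scope.

(** A comparison [h] in the other direction is a right inverse of [f] only up to a phase [V].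
    Absorbing [V] into [h] makes it strict, and compatibility survives because [V] fixes every
    [mu i]. *)
Lemma phased_coproduct_section (C : category) (J : Type) (A_ : J -> C)
    (A B : C) (kappa : forall i : J, hom (A_ i) A)
    (mu : forall i : J, hom (A_ i) B) (f : hom A B) :
  phased_coproduct mu ->
  (forall i : J, f \oc kappa i = mu i) ->
  exists r : hom B A, (forall i : J, r \oc mu i = kappa i) /\ f \oc r = idm B.
Proof.
  intros [ex_mu uniq_mu] Hf.
  destruct (ex_mu A kappa) as [h Hh].
  (* With the identity as second argument, the phase lands on the right:
     [idm B = (f \oc h) \oc V]. *)
  destruct (uniq_mu B (f \oc h) (idm B)) as [V [HV Hid]].
  { intros i. now rewrite <- comp_assoc, Hh, Hf, comp_idl. }
  exists (h \oc V); split.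
  - intros i. now rewrite <- comp_assoc, HV.
  - now rewrite comp_assoc.
Qed.

(** Here [r] has left inverse [f] and right inverse [s], and such inverses coincide. *)
Lemma iso_of_iterated_section (C : category) (a b : C)
    (f s : hom a b) (r : hom b a) :
  f \oc r = idm b -> r \oc s = idm a -> is_iso f.
Proof.
  intros Hfr Hrs.
  assert (Hfs : f = s).
  { now rewrite <- (comp_idr f), <- Hrs, comp_assoc, Hfr, comp_idl. }
  exists r; split; [now rewrite Hfs | exact Hfr].
Qed.

Lemma phased_coproduct_iso (C : category) (J : Type) (A_ : J -> C)
    (A D : C) (kappa : forall i : J, hom (A_ i) A) (g : hom A D) :
  phased_coproduct kappa -> is_iso g ->
  phased_coproduct (fun i : J => g \oc kappa i).
Proof.
  intros [ex_kappa uniq_kappa] [k [Hkg Hgk]]; split.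
  - intros B f_. destruct (ex_kappa B f_) as [f Hf].
    exists (f \oc k). intros i.
    now rewrite comp_assoc, <- (comp_assoc f), Hkg, comp_idr.
  - intros B f f' Hff'.
    destruct (uniq_kappa B (f \oc g) (f' \oc g)) as [U [HU Hf']].
    { intros i. now rewrite <- !comp_assoc. }
    (* The phase [U] of [A], conjugated by [g] to a phase of [D]; cancelling [g] in
       [f' \oc g = f \oc g \oc U] yields the factorization. *)
    exists (g \oc U \oc k); split.
    + intros i.
      now rewrite comp_assoc, <- (comp_assoc (g \oc U)), Hkg, comp_idr,
        <- comp_assoc, HU.
    + now rewrite !comp_assoc, <- Hf', <- comp_assoc, Hgk, comp_idr.
Qed.

Theorem lemma2p2 (C : category) (J : Type) (A_ : J -> C)
    (A : C) (kappa : forall i : J, hom (A_ i) A)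
    (hA : phased_coproduct kappa) :
  (forall (B : C) (mu : forall i : J, hom (A_ i) B),
     phased_coproduct mu ->
     forall f : hom A B, (forall i : J, f \oc kappa i = mu i) -> is_iso f)
  /\
  (forall (D : C) (g : hom A D),
     is_iso g -> phased_coproduct (fun i : J => g \oc kappa i)).
Proof.
  split.
  - intros B mu hB f Hf.
    destruct (phased_coproduct_section _ _ _ _ _ _ _ _ hB Hf) as [r [Hr Hfr]].
    (* The roles of [A] and [B] are swapped: by [Hr], [r] is itself a comparison morphism. *)
    destruct (phased_coproduct_section _ _ _ _ _ _ _ _ hA Hr) as [s [_ Hrs]].
    exact (iso_of_iterated_section _ _ _ _ _ _ Hfr Hrs).
  - intros D g Hg. now apply phased_coproduct_iso.
Qed.
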